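(* Every complex bilinear form $\beta:\mathbb{C}^2\times\mathbb{C}^2\to\mathbb{C}$ can be represented, with respect to some basis of $\mathbb{C}^2$, by a matrix of type $A(p)=\begin{pmatrix}0&p\\ -p&0\end{pmatrix}$ for some $p\in\mathbb{C}$, or by a matrix of type $B(p:q)=\begin{pmatrix}1&p\\ q&0\end{pmatrix}$ for some $p,q\in\mathbb{C}$.
   Context: Bilinear forms are not assumed symmetric, antisymmetric or nondegenerate. The matrix of a bilinear form $\beta$ on $\mathbb{C}^2$ with respect to a basis $(e_1,e_2)$ is $(\beta(e_i,e_j))_{i,j}$. Equivalently, changing basis acts on $2\times 2$ complex matrices by $M\mapsto G^TMG$ with $G\in GL(2,\mathbb{C})$. The parameter values $p=0$ in $A(p)$ and $p=q=0$ in $B(p:q)$ are allowed. *)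

(* Defs.v *)
From HB Require Import structures.
From mathcomp Require Import all_boot all_order all_algebra.
From mathcomp Require Import reals.
From mathcomp Require Import complex.
Set Implicit Arguments.
Unset Strict Implicit.
Unset Printing Implicit Defensive.
Import GRing.Theory.
Local Open Scope ring_scope.

Definition mx22 (K : nzRingType) (a b c d : K) : 'M[K]_2 :=
  \matrix_(i, j) nth 0 (nth [::] [:: [:: a; b]; [:: c; d]] i) j.

(* Unlike [matrix_of_form], which only uses the standard basis, this is taken
   with respect to an arbitrary family [e]. *)
Definition form_matrix (K : fieldType) (V : vectType K) (n : nat)
    (beta : V -> V -> K) (e : n.-tuple V) : 'M[K]_n :=
  \matrix_(i, j) beta (tnth e i) (tnth e j).

Definition Amx (K : nzRingType) (p : K) : 'M[K]_2 := mx22 0 p (- p) 0.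

Definition Bmx (K : nzRingType) (p q : K) : 'M[K]_2 := mx22 1 p q 0.

(* Main.v *)
Require Import Defs.
From mathcomp Require Import all_boot all_order all_algebra.
From mathcomp Require Import reals complex.
From mathcomp Require Import ring.
Import GRing.Theory.
Local Open Scope ring_scope.

(** The dichotomy is whether the quadratic form [v |-> beta v v] vanishes.
    If it does, [beta] is alternating and every basis gives a matrix [Amx p].
    If instead [beta v v != 0], the quadratic form restricted to an affine line
    [u + t v] with [u] outside the line spanned by [v] is a polynomial of
    degree exactly 2 in [t]. Over an algebraically closed field it has a root,
    which yields an isotropic [w = u + t v] that still completes [v] to a basis
    ([isotropic_on_affine_line]). Rescaling [v] by a square root of [beta v v]
    gives a basis of type [Bmx p q]. Only algebraic closure and dimension 2
    matter, so the argument is carried out at that generality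
    ([bilinear_normal_form_dim2]). *)

Lemma closed_field_quadratic_root (K : closedFieldType) (a b c : K) :
  a != 0 -> exists t, a * t ^+ 2 + b * t + c = 0.
Proof.
move=> a0.
have [t] := @solve_monicpoly K 2 (nth 0 [:: - (c / a); - (b / a)]) isT.
rewrite !big_ord_recl big_ord0 /= expr0 expr1 => et.
by exists t; rewrite et; field.
Qed.

Lemma closed_field_sqrt (K : closedFieldType) (a : K) : exists s, s ^+ 2 = a.
Proof.
have [s es] := closed_field_quadratic_root K 1 0 (- a) (oner_neq0 K).
by exists s; apply/eqP; rewrite -subr_eq0 -es; apply/eqP; ring.
Qed.

Section Dim2.
Variables (K : fieldType) (V : vectType K).
Hypothesis dimV : \dim {:V} = 2.

Lemma basis_pair_dim2 (v w : V) :
  v != 0 -> w \notin <[v]>%VS -> basis_of fullv [tuple v; w].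
Proof.
move=> v0 wv; rewrite basisEfree subvf dimV /= andbT.
by rewrite (perm_free (permEl (perm_catC [:: v] [:: w]))) free_cons span_seq1 wv seq1_free.
Qed.

Lemma exists_notin_vline_dim2 (v : V) : exists u, u \notin <[v]>%VS.
Proof.
have /subvPn[u _ uv] : ~~ (fullv <= <[v]>)%VS.
  apply/negP => /dimvS; rewrite dimV dim_vline.
  by case: (v != 0).
by exists u.
Qed.

Lemma exists_basis_pair_dim2 : exists e : 2.-tuple V, basis_of fullv e.
Proof.
by move: (vbasis _) (vbasisP {:V}); rewrite dimV => e eP; exists e.
Qed.

End Dim2.

Lemma form_matrix_pair (K : fieldType) (V : vectType K) (beta : V -> V -> K)
    (v w : V) :
  form_matrix beta [tuple v; w] =
  mx22 (beta v v) (beta v w) (beta w v) (beta w w).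
Proof.
apply/matrixP => i j; rewrite !mxE !(tnth_nth 0).
by case: i => [[|[|]]] //= _; case: j => [[|[|]]].
Qed.

Section NormalForm.
Variables (K : closedFieldType) (V : vectType K).
Variable beta : {bilinear V -> V -> K | *%R & *%R}.

(** The leading coefficient of [t |-> beta (u + t v) (u + t v)] is [beta v v],
    so the line meets the isotropic cone as soon as [v] is anisotropic. *)
Lemma isotropic_on_affine_line (u v : V) :
  beta v v != 0 -> exists t, beta (u + t *: v) (u + t *: v) = 0.
Proof.
move=> qv.
have [t et] :=
  closed_field_quadratic_root K _ (beta u v + beta v u) (beta u u) qv.
exists t; rewrite -et.
rewrite linearDl !linearDr linearZl_LR /= !linearZr_LR /= linearZl_LR /=.
ring.
Qed.

Lemma Bmx_of_anisotropic (v : V) : \dim {:V} = 2 -> beta v v != 0 ->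
  exists2 e : 2.-tuple V,
    basis_of fullv e & exists p q, form_matrix beta e = Bmx p q.
Proof.
move=> dimV qv.
have [u uv] := exists_notin_vline_dim2 _ _ dimV v.
have [t qw] := isotropic_on_affine_line u v qv.
have [s es] := closed_field_sqrt K (beta v v).
have s0 : s != 0 by rewrite -sqrf_eq0 es.
have v0 : v != 0 by apply: contra_neq qv => ->; rewrite linear0l.
set w := u + t *: v in qw.
exists [tuple s^-1 *: v; w].
  apply: basis_pair_dim2 => //; first by rewrite scaler_eq0 invr_eq0 negb_or s0.
  apply: contra uv => /vlineP[k wk].
  by apply/vlineP; exists (k / s - t); rewrite scalerBl -scalerA -wk addrK.
exists (beta (s^-1 *: v) w), (beta w (s^-1 *: v)).
rewrite form_matrix_pair qw /Bmx; congr (mx22 _ _ _ _).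
by rewrite linearZl_LR linearZr_LR /= -es; field.
Qed.

Lemma bilinear_normal_form_dim2 : \dim {:V} = 2 ->
  exists e : 2.-tuple V, basis_of fullv e /\
    ((exists p, form_matrix beta e = Amx p) \/
     (exists p q, form_matrix beta e = Bmx p q)).
Proof.
move=> dimV.
have [e eP] := exists_basis_pair_dim2 _ _ dimV.
case/tupleP: e eP => v e; case/tupleP: e => w e; rewrite (tuple0 e) => eP.
(* The quadratic form is zero iff it vanishes at these three vectors; the third
   one tests the polar form [beta v w + beta w v]. *)
have [q0|/allPn[x _ qx]] :=
  boolP (all (fun x => beta x x == 0) [:: v; w; v + w]); last first.
  by have [f fP fB] := Bmx_of_anisotropic x dimV qx; exists f; split=> //; right.
case/and4P: q0 => /eqP qv /eqP qw + _.
rewrite linearDl !linearDr /= qv qw addr0 add0r addrC addr_eq0 => /eqP alt.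
exists [tuple v; w]; split; first exact: eP.
by left; exists (beta v w); rewrite form_matrix_pair qv qw alt.
Qed.

End NormalForm.

Theorem theorem9p2 (R : realType)
    (beta : {bilinear 'cV[R[i]]_2 -> 'cV[R[i]]_2 -> R[i] | *%R & *%R}) :
  exists e : 2.-tuple 'cV[R[i]]_2,
    basis_of fullv e /\
    ((exists p : R[i], form_matrix beta e = Amx p) \/
     (exists p q : R[i], form_matrix beta e = Bmx p q)).
Proof.
by apply: bilinear_normal_form_dim2; rewrite dimvf.
Qed.
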